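(* Suppose Assumption A holds. Then for every $\epsilon>0$ and $r>0$ with $\overline{\mathrm{conv}(S)}\cap\mathbf{B}_r\neq\emptyset$, there exists an integer $k_{r,\epsilon}$ such that $$\overline{\mathrm{conv}(S)}\cap\mathbf{B}_r\subseteq\widetilde{\mathrm{TH}}_{k_{r,\epsilon}}(\tilde G)\cap\mathbf{B}_r\subseteq\big(\overline{\mathrm{conv}(S)}+\epsilon\mathbf{B}_1\big)\cap\mathbf{B}_r.$$
   Context: $\mathbf{B}_r=\{x\in\mathbb{R}^n:\|x\|_2\le r\}$. $X=(X_1,\dots,X_n)$, $\tilde X=(X_0,X_1,\dots,X_n)$, $\|\cdot\|_2$ Euclidean norm. For $f\in\mathbb{R}[X]$ of degree $d$, its homogenization is $\tilde f(\tilde X)=X_0^df(X/X_0)\in\mathbb{R}[\tilde X]$. Fix $g_1,\dots,g_m\in\mathbb{R}[X]$ and $S=\{x\in\mathbb{R}^n:g_1(x)\ge0,\dots,g_m(x)\ge0\}$. Define $\tilde S^{o}=\{\tilde x=(x_0,x)\in\mathbb{R}^{n+1}:\tilde g_j(\tilde x)\ge0\ (j=1,\dots,m),\ x_0>0\}$, $\tilde S^{c}$ the same set with $x_0\ge0$ in place of $x_0>0$, and $\tilde S=\tilde S^c\cap\{\|\tilde x\|_2=1\}$. $S$ is closed at $\infty$ if $\overline{\tilde S^{o}}=\tilde S^{c}$. For a finite set $H=\{h_1,\dots,h_r\}$ of polynomials, the $k$-th quadratic module is $\mathcal{Q}_k(H)=\{\sum_{j=0}^r\sigma_jh_j:h_0=1,\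 \sigma_j\text{ sums of squares of polynomials},\ \deg(\sigma_jh_j)\le2k\}$. Let $\tilde G=\{\tilde g_1,\dots,\tilde g_m,X_0,\|\tilde X\|_2^2-1,1-\|\tilde X\|_2^2\}$. Let $\mathcal{P}[\tilde X]_1$ be the set of linear forms (homogeneous of degree one) in $\tilde X$ together with $0$. The modified theta body is $\widetilde{\mathrm{TH}}_k(\tilde G)=\{x\in\mathbb{R}^n:\tilde l(1,x)\ge0\ \forall\tilde l\in\mathcal{Q}_k(\tilde G)\cap\mathcal{P}[\tilde X]_1\}$. A closed convex cone $K$ is pointed if $K\cap(-K)=\{0\}$. Assumption A: (i) $S$ is closed at $\infty$; (ii) the convex cone $\mathrm{conv}(\overline{\tilde S^{o}})$ is closed and pointed. *)

(* Defs.v *)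
From HB Require Import structures.
From mathcomp Require Import all_boot all_order all_algebra.
From mathcomp Require Import reals.
From mathcomp Require Import mpoly.

Set Implicit Arguments.
Unset Strict Implicit.
Unset Printing Implicit Defensive.

Import Order.TTheory GRing.Theory Num.Theory.
Local Open Scope ring_scope.

Section Defs.
Variable R : realType.

Definition rvec (N : nat) := 'I_N -> R.

Definition vnorm N (x : rvec N) : R := Num.sqrt (\sum_(i < N) x i ^+ 2).

Definition eball N (r : R) : rvec N -> Prop := fun x => vnorm x <= r.

Definition eclosure N (A : rvec N -> Prop) : rvec N -> Prop :=
  fun y => forall e : R, 0 < e ->
    exists a, A a /\ vnorm (fun i => y i - a i) < e.

Definition is_closed N (A : rvec N -> Prop) : Prop :=
  forall y, eclosure A y -> A y.

Definition cvx_hull N (A : rvec N -> Prop) : rvec N -> Prop :=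
  fun y => exists (k : nat) (lam : 'I_k -> R) (pts : 'I_k -> rvec N),
    (forall i, 0 <= lam i) /\ \sum_(i < k) lam i = 1 /\
    (forall i, A (pts i)) /\
    (forall j, y j = \sum_(i < k) lam i * pts i j).

Definition pointed N (K : rvec N -> Prop) : Prop :=
  forall y, K y -> K (fun i => - y i) -> y = (fun _ => 0).

Definition set_eq N (A B : rvec N -> Prop) : Prop := forall y, A y <-> B y.
Definition set_sub N (A B : rvec N -> Prop) : Prop := forall y, A y -> B y.

Definition add_eps_ball N (A : rvec N -> Prop) (eps : R) : rvec N -> Prop :=
  fun y => exists a b, A a /\ eball 1 b /\ (forall i, y i = a i + eps * b i).

Definition ext1 n (x : rvec n) : rvec n.+1 :=
  fun i => match unlift ord0 i with None => 1 | Some j => x j end.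

(* total degree; the zero polynomial gets degree 0 *)
Definition mdegree n (f : {mpoly R[n]}) : nat := (msize f).-1.

(* homogenization  X_0^d f(X/X_0), d = deg f; variable 0 of R[n.+1] is X_0,
   variable (lift ord0 i) is X_{i+1} *)
Definition homogenize n (f : {mpoly R[n]}) : {mpoly R[n.+1]} :=
  \sum_(m <- msupp f)
     f@_m *: ('X_ord0 ^+ (mdegree f - mdeg m)
              * \prod_(i < n) 'X_(lift ord0 i) ^+ m i).

Definition is_sos N (s : {mpoly R[N]}) : Prop :=
  exists qs : seq {mpoly R[N]}, s = \sum_(q <- qs) q ^+ 2.

(* deg p <= d  (vacuous for p = 0) *)
Definition deg_le N (p : {mpoly R[N]}) (d : nat) : Prop := (msize p <= d.+1)%N.

Definition Qmod N (k : nat) (H : seq {mpoly R[N]}) : {mpoly R[N]} -> Prop :=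
  fun p => exists (s0 : {mpoly R[N]}) (s : 'I_(size H) -> {mpoly R[N]}),
    is_sos s0 /\ deg_le s0 (2 * k) /\
    (forall j, is_sos (s j) /\ deg_le (s j * H`_j) (2 * k)) /\
    p = s0 + \sum_(j < size H) s j * H`_j.

Definition linform N (p : {mpoly R[N]}) : Prop := p \is 1.-homog.

Definition Sset n m (g : 'I_m -> {mpoly R[n]}) : rvec n -> Prop :=
  fun x => forall j, 0 <= (g j).@[x].

Definition Stilde_o n m (g : 'I_m -> {mpoly R[n]}) : rvec n.+1 -> Prop :=
  fun y => (forall j, 0 <= (homogenize (g j)).@[y]) /\ 0 < y ord0.

Definition Stilde_c n m (g : 'I_m -> {mpoly R[n]}) : rvec n.+1 -> Prop :=
  fun y => (forall j, 0 <= (homogenize (g j)).@[y]) /\ 0 <= y ord0.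

Definition closed_at_infinity n m (g : 'I_m -> {mpoly R[n]}) : Prop :=
  set_eq (eclosure (Stilde_o g)) (Stilde_c g).

Definition AssumptionA n m (g : 'I_m -> {mpoly R[n]}) : Prop :=
  closed_at_infinity g /\
  is_closed (cvx_hull (eclosure (Stilde_o g))) /\
  pointed (cvx_hull (eclosure (Stilde_o g))).

Definition normsq_poly N : {mpoly R[N]} := \sum_(i < N) 'X_i ^+ 2.

Definition Gtilde n m (g : 'I_m -> {mpoly R[n]}) : seq {mpoly R[n.+1]} :=
  [seq homogenize (g j) | j <- enum 'I_m] ++
  [:: 'X_ord0; normsq_poly n.+1 - 1; 1 - normsq_poly n.+1].

Definition THtilde n m (g : 'I_m -> {mpoly R[n]}) (k : nat) : rvec n -> Prop :=
  fun x => forall l : {mpoly R[n.+1]},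
    Qmod k (Gtilde g) l -> linform l -> 0 <= l.@[ext1 x].

End Defs.

(* Main.v *)
(** If x is not in cl(conv S), separating x
    from cl(conv S) gives a form l0 which is nonnegative on the homogenized cone
    and negative at (1, x).  As the convex cone generated by the homogenized set
    is closed and pointed, separating -y from it for each unit vector y of the
    set and using compactness gives a form l1 positive on the whole spherical
    section.  So l0 + d l1, with d > 0 small, is positive on that section and
    negative near (1, x); by Putinar's theorem it lies in some truncated quadratic
    module, and compactness of the ball yields a single order k.

    Putinar's theorem is elementary here because the sphere is among the
    constraints.  Subtracting penalties c^2 (1 - s h)^(2k) h makes the polynomial
    positive on the whole cube [-1, 1]^N; by Bernstein's expansion it is then a
    nonnegative combination of products of the 1 + X_i and 1 - X_i, and modulo
    |X|^2 - 1 each of these factors, hence each product, is a sum of squares. *)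

Require Import Defs.
From HB Require Import structures.
From mathcomp Require Import all_boot all_order all_algebra.
From mathcomp Require Import boolp classical_sets reals.
From mathcomp Require Import mpoly.
From mathcomp Require Import zify ring lra.
Import Order.TTheory GRing.Theory Num.Theory.
Local Open Scope ring_scope.

(** * Compactness of intervals and boxes, and continuity at a point *)

Section Compactness.
Set Implicit Arguments.
Unset Strict Implicit.
Context {R : realType}.

(** Heine-Borel as an induction principle. At the supremum of the [t] for which [Q] holds on
    [[a, t]], the local hypothesis carries [Q] further, unless [b] is already reached. *)
Lemma interval_induction (a b : R) (Q : (R -> Prop) -> Prop) :
  (forall A B : R -> Prop, (forall t, A t -> B t) -> Q B -> Q A) ->
  (forall A B, Q A -> Q B -> Q (fun t => A t \/ B t)) ->
  (forall t, exists2 e, 0 < e & Q (fun u => `|u - t| < e)) ->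
  Q (fun t => a <= t <= b).
Proof.
move=> Qsub QU Qloc.
have [ba|ab] := ltP b a.
  have [e _ Qe] := Qloc 0; apply: Qsub Qe => t /andP[h1 h2]; lra.
pose E : set R := fun t => a <= t <= b /\ Q (fun u => a <= u <= t).
have Ea : E a.
  split; first by rewrite lexx.
  have [e e0 Qe] := Qloc a; apply: Qsub Qe => t /andP[h1 h2].
  have -> : t = a by lra.
  by rewrite subrr normr0.
have Esup : has_sup E.
  by split; [exists a | exists b => t [/andP[]]].
have sa : a <= sup E by exact: (sup_upper_bound Esup).
have [e e0 Qe] := Qloc (sup E).
have [t [/andP[at_ tb] Qt] ts] := sup_adherent e0 Esup.
have [bs|sb] := ltP b (sup E + e / 2).
  apply: Qsub (QU _ _ Qt Qe) => u /andP[au ub].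
  have [ut|tu] := leP u t; [left|right]; first by rewrite au.
  rewrite ltr_norml; apply/andP; split; lra.
have : E (sup E + e / 2).
  split; first by apply/andP; split; lra.
  apply: Qsub (QU _ _ Qt Qe) => u /andP[au ub].
  have [ut|tu] := leP u t; [left|right]; first by rewrite au.
  rewrite ltr_norml; apply/andP; split; lra.
by move=> /(sup_upper_bound Esup) h; exfalso; lra.
Qed.

(** Coordinates are released one at a time: in the auxiliary claim the first [k] range over
    [[-B, B]] and the others stay within [e] of [x]. This principle carries the compactness
    arguments below. *)
Lemma box_induction N (B : R) (Q : (rvec R N -> Prop) -> Prop) :
  (forall A A' : rvec R N -> Prop, (forall x, A x -> A' x) -> Q A' -> Q A) ->
  (forall A A', Q A -> Q A' -> Q (fun x => A x \/ A' x)) ->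
  (forall x, exists2 e, 0 < e & Q (fun y => forall i, `|y i - x i| < e)) ->
  Q (fun x => forall i, `|x i| <= B).
Proof.
move=> Qsub QU Qloc.
suff H k x : exists2 e, 0 < e & Q (fun y => forall i : 'I_N,
    if (i < k)%N then `|y i| <= B else `|y i - x i| < e).
  have [e _ Qe] := H N (fun _ => 0).
  by apply: Qsub Qe => y yB i; rewrite ltn_ord.
elim: k x => [|k IH] x; first exact: Qloc.
have [kN|Nk] := ltnP k N; last first.
  have [e e0 Qe] := IH x; exists e => //; apply: Qsub Qe => y Hy i.
  by have := Hy i; rewrite (leq_trans (ltn_ord i) Nk) (leq_trans (ltn_ord i) (leqW Nk)).
pose i0 := Ordinal kN.
(* As in the tube lemma, the width [e] left to the other coordinates may depend on the set [J] of
   values of coordinate [k]; it shrinks to a minimum when two such sets are joined. *)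
pose Q1 (J : R -> Prop) := exists2 e, 0 < e & Q (fun y => J (y i0) /\
  forall i : 'I_N, i != i0 -> if (i < k)%N then `|y i| <= B else `|y i - x i| < e).
have /(_ (- B) B)[|||e e0 Qe] := @interval_induction _ _ Q1.
- move=> A A' sA [e e0 Qe]; exists e => //; apply: Qsub Qe => y [Ay Hy].
  by split=> //; apply: sA.
- move=> A A' [e e0 Qe] [e' e0' Qe']; exists (Num.min e e').
    by rewrite lt_min e0.
  apply: Qsub (QU _ _ Qe Qe') => y [Ay Hy].
  case: Ay => Ay; [left|right]; split=> // i /Hy; case: ifP => // _;
    by rewrite lt_min => /andP[].
- move=> t; have [e e0 Qe] := IH (fun i => if i == i0 then t else x i).
  exists e => //; exists e => //; apply: Qsub Qe => y [Hy0 Hy] i.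
  have [->|ii0] := eqVneq i i0; first by rewrite ltnn.
  exact: Hy.
exists e => //; apply: Qsub Qe => y Hy; split.
  by rewrite -ler_norml; have := Hy i0; rewrite /= ltnSn.
move=> i ii0; have := Hy i; rewrite ltnS leq_eqVlt.
by have /negbTE -> : (i : nat) != k by [].
Qed.

(** Neighbourhoods are open cubes, the shape in which [box_induction] takes its local hypothesis. *)
Definition ptcont {N} (F : rvec R N -> R) (x : rvec R N) :=
  forall eps, 0 < eps ->
    exists2 e, 0 < e & forall y, (forall i, `|y i - x i| < e) -> `|F y - F x| < eps.

Lemma ptcont_cst N (c : R) (x : rvec R N) : ptcont (fun _ => c) x.
Proof. by move=> eps e0; exists 1 => // y _; rewrite subrr normr0. Qed.

Lemma ptcont_coord N (i : 'I_N) (x : rvec R N) : ptcont (fun y => y i) x.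
Proof. by move=> eps e0; exists eps. Qed.

Lemma ptcontD N (F G : rvec R N -> R) x :
  ptcont F x -> ptcont G x -> ptcont (fun y => F y + G y) x.
Proof.
move=> cF cG eps eps0; have e2 : 0 < eps / 2 by lra.
have [e e0 He] := cF _ e2; have [e' e0' He'] := cG _ e2.
exists (Num.min e e'); first by rewrite lt_min e0.
move=> y Hy; rewrite opprD addrACA (le_lt_trans (ler_normD _ _))//.
suff: `|F y - F x| < eps / 2 /\ `|G y - G x| < eps / 2 by lra.
by split; [apply: He|apply: He'] => i; have := Hy i; rewrite lt_min => /andP[].
Qed.

Lemma ptcontM N (F G : rvec R N -> R) x :
  ptcont F x -> ptcont G x -> ptcont (fun y => F y * G y) x.
Proof.
move=> cF cG eps eps0.
pose a := `|F x| + 1; pose b := `|G x| + 1.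
have a0 : 0 < a by rewrite ltr_wpDl.
have b0 : 0 < b by rewrite ltr_wpDl.
have ea : 0 < eps / 2 / a by rewrite !divr_gt0.
(* The cap at 1 keeps [|F y|] at most [a = |F x| + 1]. *)
have eb : 0 < Num.min 1 (eps / 2 / b) by rewrite lt_min ltr01 !divr_gt0.
have [e e0 He] := cF _ eb; have [e' e0' He'] := cG _ ea.
exists (Num.min e e'); first by rewrite lt_min e0.
move=> y Hy.
have /He : forall i, `|y i - x i| < e.
  by move=> i; have := Hy i; rewrite lt_min => /andP[].
have /He' : forall i, `|y i - x i| < e'.
  by move=> i; have := Hy i; rewrite lt_min => /andP[].
rewrite lt_min => H1 /andP[H2 H3].
have -> : F y * G y - F x * G x = F y * (G y - G x) + (F y - F x) * G x by ring.
rewrite (le_lt_trans (ler_normD _ _))// !normrM.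
have Fya : `|F y| <= a.
  have -> : F y = F x + (F y - F x) by ring.
  by rewrite (le_trans (ler_normD _ _))// lerD2l ltW.
have h1 : `|F y| * `|G y - G x| <= `|G y - G x| * a by rewrite mulrC ler_wpM2l.
have h2 : `|F y - F x| * `|G x| <= `|F y - F x| * b by rewrite ler_wpM2l// lerDl.
apply: (le_lt_trans (lerD h1 h2)); rewrite [ltRHS]splitr.
by apply: ltrD; rewrite -ltr_pdivlMr.
Qed.

Lemma ptcont_sum N I (s : seq I) (F : I -> rvec R N -> R) x :
  (forall i, ptcont (F i) x) -> ptcont (fun y => \sum_(i <- s) F i y) x.
Proof.
move=> cF; elim: s => [|i s IH].
  rewrite (_ : (fun _ => _) = fun=> 0); first exact: ptcont_cst.
  by apply/funext => y; rewrite big_nil.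
rewrite (_ : (fun _ => _) = fun y => F i y + \sum_(i <- s) F i y); first exact: ptcontD.
by apply/funext => y; rewrite big_cons.
Qed.

Lemma ptcont_prod N I (s : seq I) (F : I -> rvec R N -> R) x :
  (forall i, ptcont (F i) x) -> ptcont (fun y => \prod_(i <- s) F i y) x.
Proof.
move=> cF; elim: s => [|i s IH].
  rewrite (_ : (fun _ => _) = fun=> 1); first exact: ptcont_cst.
  by apply/funext => y; rewrite big_nil.
rewrite (_ : (fun _ => _) = fun y => F i y * \prod_(i <- s) F i y); first exact: ptcontM.
by apply/funext => y; rewrite big_cons.
Qed.

Lemma ptcontX N (F : rvec R N -> R) k x :
  ptcont F x -> ptcont (fun y => F y ^+ k) x.
Proof.
move=> cF; elim: k => [|k IH].
  rewrite (_ : (fun _ => _) = fun=> 1); first exact: ptcont_cst.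
  by apply/funext => y; rewrite expr0.
rewrite (_ : (fun _ => _) = fun y => F y * F y ^+ k); first exact: ptcontM.
by apply/funext => y; rewrite exprS.
Qed.

Lemma ptcont_meval N (p : {mpoly R[N]}) x : ptcont (fun y => p.@[y]) x.
Proof.
rewrite (_ : (fun _ => _) =
  fun y => \sum_(m <- msupp p) p@_m * \prod_(i < N) y i ^+ m i); last first.
  by apply/funext => y; rewrite mevalE.
apply: ptcont_sum => m; apply: ptcontM; first exact: ptcont_cst.
by apply: ptcont_prod => i; apply: ptcontX; apply: ptcont_coord.
Qed.

Lemma ptcont_lt N (F : rvec R N -> R) x a :
  ptcont F x -> F x < a ->
  exists2 e, 0 < e & forall y, (forall i, `|y i - x i| < e) -> F y < a.
Proof.
move=> cF xa; have /cF[e e0 He] : 0 < a - F x by rewrite subr_gt0.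
exists e => // y /He; rewrite ltr_norml => /andP[_]; lra.
Qed.

Lemma ptcont_gt N (F : rvec R N -> R) x a :
  ptcont F x -> a < F x ->
  exists2 e, 0 < e & forall y, (forall i, `|y i - x i| < e) -> a < F y.
Proof.
move=> cF xa; have /cF[e e0 He] : 0 < F x - a by rewrite subr_gt0.
exists e => // y /He; rewrite ltr_norml => /andP[]; lra.
Qed.

Lemma meval_bounded_on_box N (p : {mpoly R[N]}) B :
  exists M, forall x : rvec R N, (forall i, `|x i| <= B) -> `|p.@[x]| <= M.
Proof.
apply: (@box_induction N B (fun A => exists M, forall x, A x -> `|p.@[x]| <= M)).
- by move=> A A' sA [M HM]; exists M => x /sA /HM.
- move=> A A' [M HM] [M' HM']; exists (Num.max M M') => x.
  by rewrite le_max => -[/HM ->|/HM' ->]; rewrite ?orbT.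
- move=> x; have [e e0 He] := @ptcont_meval N p x 1 ltr01; exists e => //.
  exists (`|p.@[x]| + 1) => y /He h.
  have -> : p.@[y] = p.@[x] + (p.@[y] - p.@[x]) by ring.
  by rewrite (le_trans (ler_normD _ _))// lerD2l ltW.
Qed.

End Compactness.

(** * Bernstein expansion of polynomials positive on a cube *)

Section Bernstein.
Set Implicit Arguments.
Unset Strict Implicit.
Context {R : realType}.

(** Bernstein coefficient of [t^k] in degree [D], usually written [C(j,k) / C(D,k)]; falling
    factorials turn it into a product of [k] simple ratios. *)
Definition bernstein_coef (D k j : nat) : R := (j ^_ k)%:R / (D ^_ k)%:R.

(** Multiplied by [i! (d - i)!], both sides become [(k + d)!]. *)
Lemma ffact_bin_shift k d i : (i <= d)%N ->
  ((k + i) ^_ k * 'C(k + d, k + i) = (k + d) ^_ k * 'C(d, i))%N.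
Proof.
move=> id; apply/eqP; rewrite -(eqn_pmul2r (fact_gt0 i)) -(eqn_pmul2r (fact_gt0 (d - i))).
have h1 := ffact_fact (leq_addr i k); rewrite addKn in h1.
have h2 := ffact_fact (leq_addr d k); rewrite addKn in h2.
have kid : (k + i <= k + d)%N by rewrite leq_add2l.
have h3 := bin_fact kid; rewrite subnDl in h3.
have h4 := bin_fact id.
apply/eqP; transitivity ((k + d)`!)%N.
  by rewrite -h3 -h1; ring.
by rewrite -h2 -h4; ring.
Qed.

(** Write [t^k = t^k (t + u)^(D - k)] and expand by the binomial formula; the coefficients with
    [j < k] vanish. *)
Lemma exprn_bernstein (A : comAlgType R) (t u : A) D k : (k <= D)%N -> t + u = 1 ->
  t ^+ k = \sum_(j < D.+1)
    bernstein_coef D k j *: ((t ^+ j * u ^+ (D - j)) *+ 'C(D, j)).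
Proof.
move=> /subnKC <-; move: (D - k)%N => d tu.
rewrite -addnS big_split_ord /= big1 ?add0r; last first.
  by move=> j _; rewrite /bernstein_coef ffact_small// mul0r scale0r.
rewrite -[LHS]mulr1 -[1](expr1n _ d) -tu addrC exprDn mulr_sumr.
apply: eq_bigr => i _; rewrite -mulrnAr.
have id : (i <= d)%N by rewrite -ltnS.
have nz : ((k + d) ^_ k)%:R != 0 :> R by rewrite pnatr_eq0 -lt0n ffact_gt0 leq_addr.
rewrite subnDl exprD -mulrnAr -scaler_nat -[X in _ = _ *: (_ * X)]scaler_nat -!scalerAr.
rewrite scalerA [u ^+ _ * _]mulrC mulrA; congr (_ *: _).
by rewrite /bernstein_coef mulrAC -natrM ffact_bin_shift// natrM mulrAC mulfV// mul1r.
Qed.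

Lemma prod_exprn_bernstein (A : comAlgType R) N (t u : 'I_N -> A) D (m : 'I_N -> nat) :
  (forall i, m i <= D)%N -> (forall i, t i + u i = 1) ->
  \prod_(i < N) t i ^+ m i = \sum_(f : {ffun 'I_N -> 'I_D.+1})
    (\prod_(i < N) bernstein_coef D (m i) (f i)) *:
    \prod_(i < N) ((t i ^+ f i * u i ^+ (D - f i)) *+ 'C(D, f i)).
Proof.
move=> mD tu.
rewrite (eq_bigr _ (fun i _ => exprn_bernstein (mD i) (tu i))).
by rewrite bigA_distr_bigA; apply: eq_bigr => f _; rewrite scaler_prod.
Qed.

Lemma bernstein_coef_bounds D k j : (k <= D)%N -> (j <= D)%N ->
  0 <= bernstein_coef D k j <= 1.
Proof.
move=> kD jD; apply/andP; split; first by rewrite divr_ge0.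
rewrite ler_pdivrMr ?mul1r ?ltr0n ?ffact_gt0// ler_nat.
elim: k kD => // k IH kD; rewrite !ffactnSr leq_mul ?IH ?leq_sub2r//.
exact: ltnW.
Qed.

Lemma ler_dist_prod2 (a b c d : R) : 0 <= b <= 1 -> 0 <= c <= 1 ->
  `|a * b - c * d| <= `|a - c| + `|b - d|.
Proof.
move=> /andP[b0 b1] /andP[c0 c1].
have -> : a * b - c * d = (a - c) * b + c * (b - d) by ring.
rewrite (le_trans (ler_normD _ _))// !normrM (ger0_norm b0) (ger0_norm c0).
by rewrite lerD ?ler_piMr ?ler_piMl.
Qed.

Lemma ler_dist_prod I (s : seq I) (a b : I -> R) :
  (forall i, 0 <= a i <= 1) -> (forall i, 0 <= b i <= 1) ->
  `|\prod_(i <- s) a i - \prod_(i <- s) b i| <= \sum_(i <- s) `|a i - b i|.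
Proof.
move=> a01 b01; elim: s => [|i s IH]; first by rewrite !big_nil subrr normr0.
rewrite !big_cons (le_trans (ler_dist_prod2 _ _ _ _))// ?lerD2l//.
apply/andP; split; first by apply: prodr_ge0 => j _; case/andP: (a01 j).
by apply: prodr_ile1 => j _.
Qed.

(** The coefficient is the product over [i < k] of the ratios [(j - i) / (D - i)], with truncated
    differences. Each is within [i / D] of [j / D], and the errors add up. *)
Lemma bernstein_coef_approx D k j : (0 < D)%N -> (k <= D)%N -> (j <= D)%N ->
  `|bernstein_coef D k j - (j%:R / D%:R) ^+ k| <= (k ^ 2)%:R / D%:R.
Proof.
move=> D0 kD jD; have D0' : 0 < D%:R :> R by rewrite ltr0n.
have jD01 : 0 <= (j%:R / D%:R : R) <= 1.
  by rewrite divr_ge0//= ler_pdivrMr// mul1r ler_nat.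
elim: k kD => [|k IH] kD.
  by rewrite /bernstein_coef !ffactn0 expr0 divr1 subrr normr0 divr_ge0.
have step : `|(j - k)%:R / (D - k)%:R - j%:R / D%:R| <= k%:R / D%:R :> R.
  have Dk : 0 < (D - k)%:R :> R by rewrite ltr0n subn_gt0.
  (* For [j < k] the truncated difference is 0, and [j / D] itself is below [k / D]. *)
  have [kj|jk] := leqP k j; last first.
    have /eqP -> : (j - k == 0)%N by rewrite subn_eq0 ltnW.
    rewrite mul0r sub0r normrN ger0_norm ?divr_ge0//.
    by rewrite ler_pM2r ?invr_gt0// ler_nat ltnW.
  have -> : (j - k)%:R / (D - k)%:R - j%:R / D%:R =
     - (k%:R / D%:R * ((D - j)%:R / (D - k)%:R)) :> R.
    move: Dk; rewrite !natrB// ?(ltnW kD)// => Dk.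
    by field; rewrite !gt_eqF.
  rewrite normrN ger0_norm; last by rewrite !mulr_ge0 ?invr_ge0.
  apply: ler_piMr; first by rewrite divr_ge0.
  by rewrite ler_pdivrMr// mul1r ler_nat leq_sub2l.
rewrite /bernstein_coef !ffactnSr !natrM -mulf_div exprSr.
apply: (le_trans (ler_dist_prod2 _ _ _ _)).
- rewrite divr_ge0//= ler_pdivrMr ?mul1r ?ler_nat ?leq_sub2r//.
  by rewrite ltr0n subn_gt0.
- case/andP: jD01 => h0 h1; rewrite exprn_ge0//=; exact: exprn_ile1.
apply: (le_trans (lerD (IH (ltnW kD)) step)).
rewrite -mulrDl ler_pM2r ?invr_gt0//.
have -> : (k ^ 2)%:R + k%:R = (k ^ 2 + k)%:R :> R by rewrite natrD.
by rewrite -natrM ler_nat -mulnn; nia.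
Qed.

(** Such a set stays abstract in the Bernstein argument; it is later instantiated by the sums of
    squares modulo the sphere. *)
Definition cone_multiplicative (A : algType R) (T : A -> Prop) : Prop :=
  [/\ T 1, (forall p q, T p -> T q -> T (p + q)),
      (forall p q, T p -> T q -> T (p * q)) &
      (forall c p, 0 <= c -> T p -> T (c *: p))].

Lemma cone_multiplicative_sum (A : algType R) (T : A -> Prop) I (s : seq I) (F : I -> A) :
  cone_multiplicative T -> (forall i, T (F i)) -> T (\sum_(i <- s) F i).
Proof.
case=> T1 TD TM TZ HF.
elim: s => [|i s IH]; first by rewrite big_nil -(scale0r 1); apply: TZ.
by rewrite big_cons; apply: TD.
Qed.

Lemma cone_multiplicative_prod (A : algType R) (T : A -> Prop) I (s : seq I) (F : I -> A) :
  cone_multiplicative T -> (forall i, T (F i)) -> T (\prod_(i <- s) F i).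
Proof.
case=> T1 TD TM TZ HF.
by elim: s => [|i s IH]; rewrite ?big_nil// big_cons; apply: TM.
Qed.

Lemma cone_multiplicative_exp (A : algType R) (T : A -> Prop) a k :
  cone_multiplicative T -> T a -> T (a ^+ k).
Proof.
case=> T1 TD TM TZ Ta.
by elim: k => [|k IH]; rewrite ?expr0// exprS; apply: TM.
Qed.

(* The Bernstein coefficients of [p] converge uniformly to the values of [p] on
   the grid, so they are eventually nonnegative. *)
Lemma pos_unit_box_cone N M (p : {mpoly R[N]}) (delta : R) (T : {mpoly R[M]} -> Prop)
    (t : N.-tuple {mpoly R[M]}) :
  0 < delta -> (forall x : rvec R N, (forall i, 0 <= x i <= 1) -> delta <= p.@[x]) ->
  cone_multiplicative T ->
  (forall i, T (tnth t i)) -> (forall i, T (1 - tnth t i)) -> T (p \mPo t).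
Proof.
move=> d0 pd Tc Tt Tu.
pose C : R := \sum_(m <- msupp p) `|p@_m| * \sum_(i < N) (m i ^ 2)%:R.
have C0 : 0 <= C.
  by apply: sumr_ge0 => m _; rewrite mulr_ge0// sumr_ge0.
(* [D] exceeds [C / delta], so that the total error [C / D] is at most [delta], and also every
   exponent in [p], as the expansion in degree [D] requires. *)
pose D := (Num.bound (C / delta) + msize p).+1.
have D0 : 0 < D%:R :> R by rewrite ltr0n.
have CD : C / D%:R <= delta.
  rewrite ler_pdivrMr// mulrC -ler_pdivrMr// ltW//.
  have := archi_boundP (divr_ge0 C0 (ltW d0)); move/lt_le_trans; apply.
  by rewrite ler_nat /D -addSn leqW ?leq_addr.
have mD m : m \in msupp p -> forall i : 'I_N, (m i <= D)%N.
  move=> mp i; have := msize_mdeg_lt mp; rewrite mdegE (bigD1 i)//= /D.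
  by lia.
pose q (f : {ffun 'I_N -> 'I_D.+1}) : {mpoly R[M]} := \prod_(i < N)
  ((tnth t i ^+ f i * (1 - tnth t i) ^+ (D - f i)) *+ 'C(D, f i)).
have -> : p \mPo t = \sum_(f : {ffun 'I_N -> 'I_D.+1}) (\sum_(m <- msupp p)
    p@_m * \prod_(i < N) bernstein_coef D (m i) (f i)) *: q f.
  have E m : m \in msupp p -> p@_m *: \prod_(i < N) tnth t i ^+ m i =
      \sum_(f : {ffun 'I_N -> 'I_D.+1})
        (p@_m * \prod_(i < N) bernstein_coef D (m i) (f i)) *: q f.
    move=> mp; have tu i : tnth t i + (1 - tnth t i) = 1 by rewrite addrC subrK.
    rewrite (prod_exprn_bernstein (mD m mp) tu) scaler_sumr.
    by apply: eq_bigr => f _; rewrite scalerA.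
  rewrite comp_mpolyE big_seq (eq_bigr _ E) -big_seq exchange_big /=.
  by apply: eq_bigr => f _; rewrite scaler_suml.
apply: cone_multiplicative_sum => // f.
have [T1 TD TM TZ] := Tc.
apply: (TZ); last first.
  apply: cone_multiplicative_prod => // i; rewrite -scaler_nat; apply: TZ => //.
  by apply: TM; apply: cone_multiplicative_exp.
(* The coefficient of [q f] is compared with the value of [p] at the grid point [f / D]. *)
pose x : rvec R N := fun i => (f i)%:R / D%:R.
have fD i : (f i <= D)%N by rewrite -ltnS.
have x01 i : 0 <= x i <= 1.
  by rewrite /x divr_ge0//= ler_pdivrMr// mul1r ler_nat.
have := pd _ x01; rewrite mevalE.
set a := \sum_(m <- _) _; set b := \sum_(m <- _) _ => da.
suff: `|b - a| <= C / D%:R by rewrite ler_norml => /andP[h1 h2]; lra.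
rewrite /a /b -sumrB (le_trans (ler_norm_sum _ _ _))// /C mulr_suml.
rewrite !big_seq; apply: ler_sum => m mp.
rewrite -mulrBr normrM -mulrA ler_wpM2l// mulr_suml.
apply: (le_trans (ler_dist_prod _ _ _)).
- by move=> i; apply: bernstein_coef_bounds => //; apply: mD.
- move=> i; have /andP[h0 h1] := x01 i.
  by rewrite exprn_ge0//=; apply: exprn_ile1.
- by apply: ler_sum => i _; apply: bernstein_coef_approx => //; apply: mD.
Qed.

Lemma comp_mpolyA N M L (p : {mpoly R[N]}) (s : N.-tuple {mpoly R[M]})
    (t : M.-tuple {mpoly R[L]}) :
  (p \mPo s) \mPo t = p \mPo [tuple tnth s i \mPo t | i < N].
Proof.
rewrite (comp_mpolyE p s) (comp_mpolyE p [tuple _ | i < N]) raddf_sum.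
apply: eq_bigr => m _ /=; rewrite comp_mpolyZ rmorph_prod; congr (_ *: _).
by apply: eq_bigr => i _; rewrite rmorphXn tnth_mktuple.
Qed.

(** The substitution [X_i -> 2 X_i - 1] carries [[0, 1]] onto [[-1, 1]]; its inverse produces the
    factors [(1 + X_i) / 2] and [(1 - X_i) / 2]. *)
Lemma pos_box_cone N (p : {mpoly R[N]}) (delta : R) (T : {mpoly R[N]} -> Prop) :
  0 < delta -> (forall x : rvec R N, (forall i, `|x i| <= 1) -> delta <= p.@[x]) ->
  cone_multiplicative T ->
  (forall i, T (2^-1 *: (1 + 'X_i))) -> (forall i, T (2^-1 *: (1 - 'X_i))) -> T p.
Proof.
move=> d0 pd Tc Tt Tu.
pose s : N.-tuple {mpoly R[N]} := [tuple 2 *: 'X_i - 1 | i < N].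
pose t : N.-tuple {mpoly R[N]} := [tuple 2^-1 *: (1 + 'X_i) | i < N].
have <- : (p \mPo s) \mPo t = p.
  rewrite comp_mpolyA -[RHS]comp_mpoly_id; congr (_ \mPo _).
  apply: eq_from_tnth => i; rewrite !tnth_mktuple raddfB /= comp_mpolyZ comp_mpoly1.
  rewrite comp_mpolyXU -tnth_nth tnth_mktuple scalerA mulfV ?pnatr_eq0// scale1r.
  by rewrite addrC addKr.
apply: (@pos_unit_box_cone N N _ delta) => //.
- move=> x x01; rewrite comp_mpoly_meval; apply: pd => i.
  rewrite tnth_mktuple mevalB mevalZ mevalXU meval1 ler_norml.
  by have /andP[h0 h1] := x01 i; apply/andP; split; lra.
- by move=> i; rewrite tnth_mktuple.
- move=> i; rewrite tnth_mktuple.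
  have -> : 1 - 2^-1 *: (1 + 'X_i) = 2^-1 *: (1 - 'X_i) :> {mpoly R[N]}; last exact: Tu.
  rewrite !scalerDr scalerN opprD addrA; congr (_ - _).
  have h : 1 = 2^-1 + 2^-1 :> R by lra.
  by rewrite -{1}[1]scale1r {1}h scalerDl addrK.
Qed.

End Bernstein.

(** * Sums of squares, quadratic modules and Putinar's theorem on the sphere *)

Section Putinar.
Set Implicit Arguments.
Unset Strict Implicit.
Context {R : realType}.

Lemma is_sos0 N : is_sos (0 : {mpoly R[N]}).
Proof. by exists [::]; rewrite big_nil. Qed.

Lemma is_sos_sqr N (q : {mpoly R[N]}) : is_sos (q ^+ 2).
Proof. by exists [:: q]; rewrite big_seq1. Qed.

Lemma is_sosD N (p q : {mpoly R[N]}) : is_sos p -> is_sos q -> is_sos (p + q).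
Proof. by move=> [s ->] [t ->]; exists (s ++ t); rewrite big_cat. Qed.

Lemma is_sosM N (p q : {mpoly R[N]}) : is_sos p -> is_sos q -> is_sos (p * q).
Proof.
move=> [s ->] [t ->]; elim: s => [|a s IH].
  by rewrite big_nil mul0r; apply: is_sos0.
rewrite big_cons mulrDl; apply: is_sosD => //.
exists [seq a * b | b <- t]; rewrite big_map mulr_sumr.
by apply: eq_bigr => b _; rewrite exprMn.
Qed.

Lemma is_sosZ N c (p : {mpoly R[N]}) : 0 <= c -> is_sos p -> is_sos (c *: p).
Proof.
move=> c0 [s ->]; exists [seq Num.sqrt c *: b | b <- s].
rewrite big_map scaler_sumr; apply: eq_bigr => b _.
by rewrite exprZn sqr_sqrtr.
Qed.

Lemma is_sos_sum N I (s : seq I) (F : I -> {mpoly R[N]}) :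
  (forall i, is_sos (F i)) -> is_sos (\sum_(i <- s) F i).
Proof.
move=> HF; elim: s => [|i s IH]; first by rewrite big_nil; apply: is_sos0.
by rewrite big_cons; apply: is_sosD.
Qed.

Lemma is_sos_ge0 N (p : {mpoly R[N]}) x : is_sos p -> 0 <= p.@[x].
Proof.
move=> [s ->]; rewrite raddf_sum; apply: sumr_ge0 => q _ /=.
by rewrite rmorphXn sqr_ge0.
Qed.

(** Sums of squares modulo the ideal of the sphere. The cofactor [q] is arbitrary, which makes the
    set closed under products. *)
Definition sos_mod_sphere N (p : {mpoly R[N]}) : Prop :=
  exists s q, is_sos s /\ p = s + q * (1 - normsq_poly R N).

Lemma sos_mod_sphere_cone N : cone_multiplicative (@sos_mod_sphere N).
Proof.
split.
- by exists 1, 0; rewrite mul0r addr0; split=> //; rewrite -(expr1n _ 2); apply: is_sos_sqr.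
- move=> _ _ [s [q [hs ->]]] [s' [q' [hs' ->]]]; exists (s + s'), (q + q').
  by split; [apply: is_sosD | rewrite mulrDl addrACA].
- move=> _ _ [s [q [hs ->]]] [s' [q' [hs' ->]]].
  exists (s * s'), (s * q' + q * s' + q * q' * (1 - normsq_poly R N)).
  by split; [apply: is_sosM | ring].
- move=> c _ c0 [s [q [hs ->]]]; exists (c *: s), (c *: q).
  by split; [apply: is_sosZ | rewrite scalerDr scalerAl].
Qed.

(** On the sphere [1 - X_i^2] is the sum of the other [X_j^2], so [(1 + e X_i) / 2] equals
    [((1 + e X_i) / 2)^2] plus the sum of the [(X_j / 2)^2]. The sign [e] treats [1 + X_i] and
    [1 - X_i] together. *)
Lemma sos_mod_sphere_coord N (i : 'I_N) (e : {mpoly R[N]}) : e ^+ 2 = 1 ->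
  sos_mod_sphere (2^-1 *: (1 + e * 'X_i)).
Proof.
move=> e1.
exists ((2^-1 *: (1 + e * 'X_i)) ^+ 2 + \sum_(j < N | j != i) (2^-1 *: 'X_j) ^+ 2).
exists ((2^-1) ^+ 2 *: 1); split.
  by apply: is_sosD; [apply: is_sos_sqr | rewrite -big_filter; apply: is_sos_sum => j;
    apply: is_sos_sqr].
rewrite -scalerAl mul1r /normsq_poly [\sum_(j < N) _](bigD1 i)//=.
under eq_bigr do rewrite exprZn.
rewrite -scaler_sumr exprZn -addrA -scalerDr -scalerDr.
set S := \sum_(j < N | _) _.
have -> : (1 + e * 'X_i) ^+ 2 + (S + (1 - ('X_i ^+ 2 + S))) =
   2 *: (1 + e * 'X_i) :> {mpoly R[N]}.
  have eX : (e * 'X_i) ^+ 2 = 'X_i ^+ 2 by rewrite exprMn e1 mul1r.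
  by rewrite -eX scaler_nat; ring.
by rewrite scalerA; congr (_ *: _); field.
Qed.

Lemma pos_box_sos_mod_sphere N (p : {mpoly R[N]}) delta :
  0 < delta -> (forall x : rvec R N, (forall i, `|x i| <= 1) -> delta <= p.@[x]) ->
  sos_mod_sphere p.
Proof.
move=> d0 pd; apply: (pos_box_cone d0 pd (@sos_mod_sphere_cone N)) => i.
  by rewrite -[X in _ + X]mul1r; apply: sos_mod_sphere_coord; rewrite expr1n.
by rewrite -mulN1r; apply: sos_mod_sphere_coord; rewrite sqrrN expr1n.
Qed.

(** The untruncated module: the order is chosen only at the end, from the sizes in a given
    representation. *)
Definition quad_module N (H : seq {mpoly R[N]}) (p : {mpoly R[N]}) : Prop :=
  exists (s0 : {mpoly R[N]}) (s : 'I_(size H) -> {mpoly R[N]}),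
    [/\ is_sos s0, (forall j, is_sos (s j)) & p = s0 + \sum_(j < size H) s j * H`_j].

Lemma quad_module_Qmod N (H : seq {mpoly R[N]}) p :
  quad_module H p -> exists k, Qmod k H p.
Proof.
move=> [s0 [s [h0 hs ->]]].
exists (msize s0 + \sum_(j < size H) msize (s j * H`_j))%N, s0, s.
split=> //; split; first by rewrite /deg_le; lia.
split=> // j; split=> //; rewrite /deg_le (bigD1 j)//=; lia.
Qed.

Lemma Qmod_leq N (H : seq {mpoly R[N]}) p k l : (k <= l)%N -> Qmod k H p -> Qmod l H p.
Proof.
move=> kl [s0 [s [h0 [d0 [hs ->]]]]]; exists s0, s; split=> //; split.
  by move: d0; rewrite /deg_le; lia.
split=> // j; have [hj dj] := hs j; split=> //; move: dj; rewrite /deg_le; lia.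
Qed.

Lemma quad_moduleD N (H : seq {mpoly R[N]}) p q :
  quad_module H p -> quad_module H q -> quad_module H (p + q).
Proof.
move=> [s0 [s [h0 hs ->]]] [t0 [t [k0 kt ->]]].
exists (s0 + t0), (fun j => s j + t j); split; first exact: is_sosD.
  by move=> j; apply: is_sosD.
rewrite addrACA -big_split; congr (_ + _).
by apply: eq_bigr => j _; rewrite mulrDl.
Qed.

Lemma quad_module_sos N (H : seq {mpoly R[N]}) p : is_sos p -> quad_module H p.
Proof.
move=> hp; exists p, (fun=> 0); split=> //; first by move=> _; apply: is_sos0.
by rewrite big1 ?addr0// => j _; rewrite mul0r.
Qed.

Lemma quad_module_mem N (H : seq {mpoly R[N]}) s h :
  h \in H -> is_sos s -> quad_module H (s * h).
Proof.
move=> hH hs; have hi : (index h H < size H)%N by rewrite index_mem.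
exists 0, (fun j => if j == Ordinal hi then s else 0); split; first exact: is_sos0.
  by move=> j; case: ifP => // _; apply: is_sos0.
rewrite add0r (bigD1 (Ordinal hi))//= eqxx nth_index// big1 ?addr0//.
by move=> j /negbTE ->; rewrite mul0r.
Qed.

(** Since [q = ((q + 1) / 2)^2 - ((q - 1) / 2)^2] and both signs of the sphere equation lie in [H],
    the module contains the whole ideal of the sphere equation. *)
Lemma quad_module_sphere N (H : seq {mpoly R[N]}) (q : {mpoly R[N]}) :
  normsq_poly R N - 1 \in H -> 1 - normsq_poly R N \in H ->
  quad_module H (q * (1 - normsq_poly R N)).
Proof.
move=> H1 H2.
have -> : q * (1 - normsq_poly R N) =
    (2^-1 *: (q + 1)) ^+ 2 * (1 - normsq_poly R N) +
    (2^-1 *: (q - 1)) ^+ 2 * (normsq_poly R N - 1).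
  rewrite !exprZn -!scalerAl -scalerDr.
  have -> : (q + 1) ^+ 2 * (1 - normsq_poly R N) + (q - 1) ^+ 2 * (normsq_poly R N - 1) =
    4 *: (q * (1 - normsq_poly R N)) by rewrite scaler_nat; ring.
  have h4 : 2^-1 ^+ 2 * 4 = 1 :> R by field.
  by rewrite scalerA h4 scale1r.
by apply: quad_moduleD; apply: quad_module_mem => //; apply: is_sos_sqr.
Qed.

(** Induction on [K], from [(1 - y) (1 + (K + 1) y) <= 1 + K y]. *)
Lemma penalty_le1 (y : R) K : 0 <= y <= 1 -> (1 - y) ^+ K * (1 + K%:R * y) <= 1.
Proof.
move=> /andP[y0 y1]; elim: K => [|K IH]; first by rewrite expr0 mul0r addr0 mulr1.
apply: le_trans IH; rewrite exprSr -mulrA ler_wpM2l ?exprn_ge0 ?subr_ge0//.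
rewrite -natr1; have : 0 <= K%:R :> R by []. nra.
Qed.

(** For [y <= 0] the even power makes the left side nonpositive; otherwise [penalty_le1] applies to
    [s y]. *)
Lemma penalty_bound (y s : R) k : 0 < s -> (0 < k)%N -> s * y <= 1 ->
  (1 - s * y) ^+ (2 * k) * y <= (s * (2 * k)%:R)^-1.
Proof.
move=> s0 k0 sy1; have K0 : 0 < (2 * k)%:R :> R by rewrite ltr0n muln_gt0.
have P0 : 0 <= (1 - s * y) ^+ (2 * k) by rewrite exprM exprn_ge0// sqr_ge0.
have [y0|y0] := leP y 0.
  apply: (@le_trans _ _ 0); first by rewrite mulr_ge0_le0.
  by rewrite invr_ge0 mulr_ge0// ltW.
have sy0 : 0 <= s * y by rewrite mulr_ge0 ?ltW.
have /(@penalty_le1 _ (2 * k)) : 0 <= s * y <= 1 by rewrite sy0.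
rewrite -div1r ler_pdivlMr ?mulr_gt0//; set P := (_ ^+ _) in P0 *; set K := _%:R in K0 *.
by nra.
Qed.

(** Each point either violates a constraint strictly or makes [f] positive. By continuity half of
    that value persists nearby, and compactness of the box gives a uniform [eta]. *)
Lemma pos_or_violated N (f : {mpoly R[N]}) (H : seq {mpoly R[N]}) B :
  (forall x : rvec R N, (forall h, h \in H -> 0 <= h.@[x]) -> 0 < f.@[x]) ->
  exists2 eta, 0 < eta & forall x : rvec R N, (forall i, `|x i| <= B) ->
    eta <= f.@[x] \/ exists j : 'I_(size H), (H`_j).@[x] <= - eta.
Proof.
move=> fH.
apply: (@box_induction R N B (fun A => exists2 eta, 0 < eta & forall x, A x ->
    eta <= f.@[x] \/ exists j : 'I_(size H), (H`_j).@[x] <= - eta)).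
- by move=> A A' sA [eta e0 He]; exists eta => // x /sA /He.
- move=> A A' [eta e0 He] [eta' e0' He']; exists (Num.min eta eta').
    by rewrite lt_min e0.
  move=> x [/He|/He'] [h|[j h]].
  + by left; rewrite ge_min h.
  + by right; exists j; apply: (le_trans h); rewrite lerN2 ge_min lexx.
  + by left; rewrite ge_min h orbT.
  + by right; exists j; apply: (le_trans h); rewrite lerN2 ge_min lexx orbT.
move=> x.
have [[j hj]|nh] := pselect (exists j : 'I_(size H), (H`_j).@[x] < 0).
  have h' : (H`_j).@[x] < (H`_j).@[x] / 2 by lra.
  have [e e0 He] := ptcont_lt (ptcont_meval (H`_j) x) h'.
  exists e => //; exists (- ((H`_j).@[x] / 2)); first by lra.
  by move=> y /He hy; right; exists j; rewrite opprK ltW.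
have fx : 0 < f.@[x].
  apply: fH => h hH; rewrite leNgt; apply/negP => hx; apply: nh.
  have hi : (index h H < size H)%N by rewrite index_mem.
  by exists (Ordinal hi); rewrite /= nth_index.
have f' : f.@[x] / 2 < f.@[x] by lra.
have [e e0 He] := ptcont_gt (ptcont_meval f x) f'.
exists e => //; exists (f.@[x] / 2); first by lra.
by move=> y /He hy; left; rewrite ltW.
Qed.

Lemma meval_seq_bounded_on_box N (H : seq {mpoly R[N]}) B :
  exists2 M, 0 <= M & forall x : rvec R N, (forall i, `|x i| <= B) ->
    forall h, h \in H -> `|h.@[x]| <= M.
Proof.
elim: H => [|h H [M M0 HM]]; first by exists 0.
have [M' HM'] := meval_bounded_on_box h B.
exists (Num.max M M'); first by rewrite le_max M0.
move=> x xB k; rewrite inE => /predU1P[->|kH]; rewrite le_max.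
  by rewrite HM' ?orbT.
by rewrite HM.
Qed.

(* The multiplier [c^2 (1 - s h)^(2k)] makes [sigma * h] uniformly small where
   [0 <= s h <= 1] and very negative where [h] is bounded away from [0] from below. *)
Lemma penalization N (f : {mpoly R[N]}) (H : seq {mpoly R[N]}) B :
  (forall x : rvec R N, (forall h, h \in H -> 0 <= h.@[x]) -> 0 < f.@[x]) ->
  exists (s : 'I_(size H) -> {mpoly R[N]}) (delta : R),
  [/\ 0 < delta, (forall j, is_sos (s j)) &
    forall x : rvec R N, (forall i, `|x i| <= B) ->
      delta <= (f - \sum_(j < size H) s j * H`_j).@[x]].
Proof.
move=> fH; have [eta eta0 Heta] := pos_or_violated B fH.
have [M M0 HM] := meval_seq_bounded_on_box (f :: H) B.
(* As [M] bounds [f] and all [h] on the box, [s h < 1] there. The constant [c] below is taken so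
   large that [c^2 eta >= c eta >= M + 1]. *)
pose s := (M + 1)^-1; have s0 : 0 < s by rewrite invr_gt0 ltr_wpDl.
pose c := (M + 1) / eta + 1.
have c1 : 1 <= c by rewrite lerDr divr_ge0 ?addr_ge0// ltW.
have ceta : M + 1 <= c ^+ 2 * eta.
  apply: (@le_trans _ _ (c * eta)).
    by rewrite mulrDl divfK ?gt_eqF// mul1r lerDl ltW.
  rewrite ler_pM2r// expr2 ler_peMl//; lra.
pose delta := Num.min eta 1 / 2.
have d0 : 0 < delta by rewrite divr_gt0// lt_min eta0 ltr01.
have d_eta : delta <= eta / 2 by rewrite ler_pM2r ?invr_gt0// ge_min lexx.
have d_1 : delta <= 1 / 2 by rewrite ler_pM2r ?invr_gt0// ge_min lexx orbT.
pose C := (size H)%:R * c ^+ 2 / s.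
have C0 : 0 <= C by apply: divr_ge0; [rewrite mulr_ge0 ?sqr_ge0 | exact: ltW].
(* A penalty is at most [c^2 / (s 2k)]; this [k] keeps the sum of [size H] such bounds below
   [delta]. *)
pose k := (Num.bound (C / delta)).+1.
have Ck : C / (2 * k)%:R <= delta.
  have K0 : 0 < (2 * k)%:R :> R by rewrite ltr0n.
  rewrite ler_pdivrMr// mulrC -ler_pdivrMr//.
  apply: le_trans (ltW (archi_boundP (divr_ge0 C0 (ltW d0)))) _.
  by rewrite ler_nat (leq_trans (leqnSn _))// leq_pmull.
pose beta := c ^+ 2 / (s * (2 * k)%:R).
have beta0 : 0 <= beta by rewrite divr_ge0 ?sqr_ge0// mulr_ge0// ltW.
have sbeta : (size H)%:R * beta <= delta.
  by apply: le_trans Ck; rewrite /beta /C invfM !mulrA.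
pose sig (j : 'I_(size H)) : {mpoly R[N]} := (c *: (1 - s *: H`_j) ^+ k) ^+ 2.
exists sig, delta; split=> // [j|x xB]; first exact: is_sos_sqr.
have Hx (j : 'I_(size H)) : `|(H`_j).@[x]| <= M.
  by apply: HM => //; rewrite inE mem_nth ?orbT.
have fx : `|f.@[x]| <= M by apply: HM => //; rewrite inE eqxx.
pose tau (j : 'I_(size H)) := c ^+ 2 * ((1 - s * (H`_j).@[x]) ^+ (2 * k) * (H`_j).@[x]).
have -> : (f - \sum_(j < size H) sig j * H`_j).@[x] = f.@[x] - \sum_(j < size H) tau j.
  rewrite mevalB; congr (_ + - _); rewrite raddf_sum; apply: eq_bigr => j _ /=.
  rewrite mevalM /sig rmorphXn /= mevalZ rmorphXn /= mevalB meval1 mevalZ.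
  by rewrite /tau exprMn -exprM [(k * 2)%N]mulnC -mulrA.
have tau_beta j : tau j <= beta.
  rewrite /tau /beta ler_wpM2l ?sqr_ge0//; apply: penalty_bound => //.
  rewrite /s mulrC ler_pdivrMr ?mul1r; last by lra.
  by have := Hx j; rewrite ler_norml => /andP[]; lra.
have tau_sum (P : pred 'I_(size H)) : \sum_(j | P j) tau j <= delta.
  apply: le_trans sbeta; rewrite big_mkcond /=.
  apply: (@le_trans _ _ (\sum_(j < size H) beta)).
    by apply: ler_sum => j _; case: ifP.
  by rewrite sumr_const card_ord mulr_natl.
(* Either [f >= eta] and the penalties total at most [delta <= eta / 2], or one penalty, at most
   [-(M + 1)], outweighs [f >= -M] while the others total at most [delta <= 1 / 2]. *)
case: (Heta x xB) => [fe|[j hj]].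
  by have := tau_sum predT; lra.
rewrite (bigD1 j)//=; have := tau_sum (fun i => i != j).
(* Where [h_j <= -eta], the power of [1 - s h_j] is at least 1, so the penalty is at most
   [c^2 h_j <= -c^2 eta]. *)
have : tau j <= - (M + 1).
  rewrite /tau lerNr -mulrN -mulrN; apply: (le_trans ceta).
  rewrite ler_wpM2l ?sqr_ge0//; apply: (@le_trans _ _ (- (H`_j).@[x])); first lra.
  rewrite ler_peMl//; first by lra.
  apply: exprn_ege1; rewrite lerDl oppr_ge0 mulr_ge0_le0//; lra.
by move: fx; rewrite ler_norml => /andP[]; lra.
Qed.

(** After subtraction of the penalties [f] is positive on the cube, hence a sum of squares modulo
    the sphere; the penalties added back and the multiple of the sphere equation both lie in the
    module. *)
Theorem putinar_sphere N (f : {mpoly R[N]}) (H : seq {mpoly R[N]}) :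
  normsq_poly R N - 1 \in H -> 1 - normsq_poly R N \in H ->
  (forall x : rvec R N, (forall h, h \in H -> 0 <= h.@[x]) -> 0 < f.@[x]) ->
  exists k, Qmod k H f.
Proof.
move=> H1 H2 fH; apply: quad_module_Qmod.
have [s [delta [d0 hs pd]]] := penalization 1 fH.
have [t [q [ht E]]] := pos_box_sos_mod_sphere d0 pd.
have -> : f = t + q * (1 - normsq_poly R N) + \sum_(j < size H) s j * H`_j.
  by rewrite -E subrK.
apply: quad_moduleD.
  by apply: quad_moduleD; [apply: quad_module_sos | apply: quad_module_sphere].
by exists 0, s; split=> //; [apply: is_sos0 | rewrite add0r].
Qed.

End Putinar.

(** * Closures, convex hulls and separation from closed convex sets *)

Section Convexity.
Set Implicit Arguments.
Unset Strict Implicit.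
Context {R : realType}.

Definition dotp N (u v : rvec R N) : R := \sum_(i < N) u i * v i.

Lemma dotpDl N (u v w : rvec R N) : dotp (fun i => u i + v i) w = dotp u w + dotp v w.
Proof. by rewrite /dotp -big_split; apply: eq_bigr => i _; rewrite mulrDl. Qed.

Lemma dotpZl N c (u w : rvec R N) : dotp (fun i => c * u i) w = c * dotp u w.
Proof. by rewrite /dotp mulr_sumr; apply: eq_bigr => i _; rewrite mulrA. Qed.

Lemma dotpC N (u v : rvec R N) : dotp u v = dotp v u.
Proof. by apply: eq_bigr => i _; rewrite mulrC. Qed.

Lemma dotpDr N (u v w : rvec R N) : dotp w (fun i => u i + v i) = dotp w u + dotp w v.
Proof. by rewrite dotpC dotpDl !(dotpC w). Qed.

Lemma dotpZr N c (u w : rvec R N) : dotp w (fun i => c * u i) = c * dotp w u.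
Proof. by rewrite dotpC dotpZl (dotpC w). Qed.

Lemma dotpN N (u w : rvec R N) : dotp w (fun i => - u i) = - dotp w u.
Proof. by rewrite /dotp -sumrN; apply: eq_bigr => i _; rewrite mulrN. Qed.

Lemma dotp_sumr N k (lam : 'I_k -> R) (pts : 'I_k -> rvec R N) w :
  dotp w (fun j => \sum_(i < k) lam i * pts i j) = \sum_(i < k) lam i * dotp w (pts i).
Proof.
rewrite /dotp; under eq_bigr do rewrite mulr_sumr.
rewrite exchange_big; apply: eq_bigr => i _; rewrite mulr_sumr.
by apply: eq_bigr => j _; ring.
Qed.

Lemma sqdotpD N (v w : rvec R N) t :
  dotp (fun i => v i + t * w i) (fun i => v i + t * w i) =
  dotp v v + t * dotp v w + (t * dotp v w + t * (t * dotp w w)).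
Proof. by rewrite dotpDr !dotpDl !dotpZr !dotpZl (dotpC w v). Qed.

Lemma ptcont_dotp N (w x : rvec R N) : ptcont (dotp w) x.
Proof.
apply: ptcont_sum => i; apply: ptcontM; first exact: ptcont_cst.
exact: ptcont_coord.
Qed.

Lemma sqr_le_dotp N (u : rvec R N) i : u i ^+ 2 <= dotp u u.
Proof.
rewrite /dotp (bigD1 i)//= -expr2 lerDl sumr_ge0// => j _.
by rewrite -expr2 sqr_ge0.
Qed.

Lemma dotp_ge0 N (u : rvec R N) : 0 <= dotp u u.
Proof. by apply: sumr_ge0 => j _; rewrite -expr2 sqr_ge0. Qed.

Lemma dotp_eq0 N (u : rvec R N) : dotp u u = 0 -> u = (fun=> 0).
Proof.
move=> u0; apply/funext => i; apply/eqP; rewrite -sqrf_eq0 eq_le sqr_ge0 andbT.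
by rewrite -u0 sqr_le_dotp.
Qed.

Lemma vnormE N (u : rvec R N) : vnorm u = Num.sqrt (dotp u u).
Proof. by congr Num.sqrt; apply: eq_bigr => i _; rewrite expr2. Qed.

Lemma norm_le_vnorm N (u : rvec R N) i : `|u i| <= vnorm u.
Proof. by rewrite vnormE -sqrtr_sqr ler_wsqrtr// sqr_le_dotp. Qed.

Lemma vnorm_le_sum N (u : rvec R N) : vnorm u <= \sum_(i < N) `|u i|.
Proof.
rewrite -[leRHS]ger0_norm ?sumr_ge0// -sqrtr_sqr; apply: ler_wsqrtr.
rewrite expr2 mulr_suml; apply: ler_sum => i _.
rewrite -[leLHS]ger0_norm ?sqr_ge0// normrX expr2 ler_wpM2l// (bigD1 i)//= lerDl.
exact: sumr_ge0.
Qed.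

(** Division by [N + 1] rather than [N] keeps the sum of the [N] coordinates strictly below [e],
    also for [N = 0]. *)
Lemma vnorm_lt N (u : rvec R N) e : 0 < e -> (forall i, `|u i| < e / N.+1%:R) -> vnorm u < e.
Proof.
move=> e0 ue; apply: (le_lt_trans (vnorm_le_sum _)).
apply: (@le_lt_trans _ _ (\sum_(i < N) e / N.+1%:R)).
  by apply: ler_sum => i _; apply: ltW.
rewrite sumr_const card_ord -[_ *+ N]mulr_natr mulrAC ltr_pdivrMr ?ltr0n//.
by rewrite ltr_pM2l// ltr_nat.
Qed.

Lemma eclosureP N (A : rvec R N -> Prop) y :
  eclosure A y <-> forall e, 0 < e -> exists a, A a /\ forall i, `|y i - a i| < e.
Proof.
split=> H e e0.
  have [a [Aa ya]] := H _ e0; exists a; split=> // i.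
  exact: le_lt_trans (norm_le_vnorm (fun i => y i - a i) i) ya.
have e0' : 0 < e / N.+1%:R by rewrite divr_gt0// ltr0n.
by have [a [Aa ya]] := H _ e0'; exists a; split=> //; apply: vnorm_lt.
Qed.

Lemma sub_eclosure N (A : rvec R N -> Prop) y : A y -> eclosure A y.
Proof. by move=> Ay; apply/eclosureP => e e0; exists y; split=> // i; rewrite subrr normr0. Qed.

Lemma eclosure_closed N (A : rvec R N -> Prop) : is_closed (eclosure A).
Proof.
move=> y /eclosureP H; apply/eclosureP => e e0.
have e2 : 0 < e / 2 by lra.
have [a [/eclosureP/(_ _ e2)[b [Ab ab]] ya]] := H _ e2.
exists b; split=> // i; have := ya i; have := ab i.
by rewrite !ltr_norml => /andP[? ?] /andP[? ?]; apply/andP; split; lra.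
Qed.

Lemma not_closed_nbhs N (A : rvec R N -> Prop) x : is_closed A -> ~ A x ->
  exists2 e, 0 < e & forall y, (forall i, `|y i - x i| < e) -> ~ A y.
Proof.
move=> cA nAx; apply: contrapT => H; apply: nAx; apply: cA; apply/eclosureP => e e0.
apply: contrapT => H'; apply: H; exists e => // y yx Ay; apply: H'.
by exists y; split=> // i; rewrite distrC.
Qed.

Definition convex_set N (A : rvec R N -> Prop) := forall a b t, A a -> A b ->
  0 <= t <= 1 -> A (fun i => (1 - t) * a i + t * b i).

(** The two combinations are concatenated, with weights scaled by [1 - t] and [t]. *)
Lemma cvx_hull_convex N (A : rvec R N -> Prop) : convex_set (cvx_hull A).
Proof.
move=> a b t [k [lam [pts [l0 [l1 [Ap ya]]]]]] [k' [lam' [pts' [l0' [l1' [Ap' yb]]]]]].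
move=> /andP[t0 t1].
exists (k + k')%N, (fun i => match split i with inl a => (1 - t) * lam a | inr b => t * lam' b end),
  (fun i => match split i with inl a => pts a | inr b => pts' b end).
have splitl i : split (lshift k' i) = inl i :> 'I_k + 'I_k' by exact: (unsplitK (inl i)).
have splitr i : split (rshift k i) = inr i :> 'I_k + 'I_k' by exact: (unsplitK (inr i)).
split; first by move=> i; case: (split i) => j; rewrite mulr_ge0// subr_ge0.
split.
  rewrite big_split_ord /=.
  under eq_bigr do rewrite splitl.
  under [X in _ + X]eq_bigr do rewrite splitr.
  by rewrite -!mulr_sumr l1 l1' !mulr1 subrK.
split; first by move=> i; case: (split i).
move=> j; rewrite ya yb big_split_ord /= !mulr_sumr; congr (_ + _); apply: eq_bigr => i _.
  by rewrite splitl mulrA.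
by rewrite splitr mulrA.
Qed.

Lemma eclosure_convex N (A : rvec R N -> Prop) : convex_set A -> convex_set (eclosure A).
Proof.
move=> cA a b t /eclosureP Ha /eclosureP Hb t01; apply/eclosureP => e e0.
have e2 : 0 < e / 2 by lra.
have [a' [Aa' aa']] := Ha _ e2; have [b' [Ab' bb']] := Hb _ e2.
exists (fun i => (1 - t) * a' i + t * b' i); split; first exact: cA.
move=> i; case/andP: t01 => t0 t1.
have -> : (1 - t) * a i + t * b i - ((1 - t) * a' i + t * b' i) =
  (1 - t) * (a i - a' i) + t * (b i - b' i) by ring.
rewrite (le_lt_trans (ler_normD _ _))// !normrM (ger0_norm t0) ger0_norm ?subr_ge0//.
have h1 : (1 - t) * `|a i - a' i| <= (1 - t) * (e / 2).
  by rewrite ler_wpM2l ?subr_ge0// ltW.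
have h2 : t * `|b i - b' i| <= t * (e / 2) by rewrite ler_wpM2l// ltW.
lra.
Qed.

Lemma sub_cvx_hull N (A : rvec R N -> Prop) y : A y -> cvx_hull A y.
Proof.
move=> Ay; exists 1%N, (fun=> 1), (fun=> y); split=> //.
by split; [rewrite big_ord1 | split=> // j; rewrite big_ord1 mul1r].
Qed.

Lemma cvx_hull_halfspace N (A : rvec R N -> Prop) v c :
  (forall a, A a -> c <= dotp v a) -> forall a, cvx_hull A a -> c <= dotp v a.
Proof.
move=> H a [k [lam [pts [l0 [l1 [Ap ya]]]]]].
have -> : a = fun j => \sum_(i < k) lam i * pts i j by apply/funext.
rewrite dotp_sumr -[c]mul1r -l1 mulr_suml; apply: ler_sum => i _.
by rewrite ler_wpM2l// H.
Qed.

Lemma eclosure_halfspace N (A : rvec R N -> Prop) v c :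
  (forall a, A a -> c <= dotp v a) -> forall a, eclosure A a -> c <= dotp v a.
Proof.
move=> H a /eclosureP Ha; rewrite leNgt; apply/negP => ac.
have [e e0 He] := ptcont_lt (ptcont_dotp v a) ac.
have [b [Ab ab]] := Ha e e0; have := H _ Ab; rewrite leNgt => /negP; apply.
by apply: He => i; rewrite distrC.
Qed.

Definition sqdist N (z y : rvec R N) := dotp (fun i => y i - z i) (fun i => y i - z i).

(** By contradiction: without a minimizer, near each point of [D] one element of [D] beats all
    others nearby, and near any other point there is nothing to beat. Compactness yields an element
    at least as good as all of [D] in a large box. *)
Lemma nearest_point N (D : rvec R N -> Prop) z : is_closed D -> (exists a, D a) ->
  exists2 p, D p & forall y, D y -> sqdist z p <= sqdist z y.
Proof.
move=> cD [a Da]; apply: contrapT => nmin.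
have better p : D p -> exists2 y, D y & sqdist z y < sqdist z p.
  move=> Dp; apply: contrapT => nb; apply: nmin; exists p => // y Dy.
  by rewrite leNgt; apply/negP => h; apply: nb; exists y.
(* Outside this box some coordinate of [y] is at distance at least [1 + sqdist z a] from that of
   [z], so [y] is no closer to [z] than [a]. *)
pose B := \sum_(i < N) `|z i| + (1 + sqdist z a).
have [|||y0 Dy0 Hy0] := @box_induction R N B
  (fun A => exists2 y0, D y0 & forall y, A y -> D y -> sqdist z y0 <= sqdist z y).
- by move=> A A' sA [y0 Dy0 H]; exists y0 => // y /sA; apply: H.
- move=> A A' [y0 Dy0 H] [y1 Dy1 H1].
  have [h|h] := leP (sqdist z y0) (sqdist z y1).
    by exists y0 => // y [/H//|Ay Dy]; apply: le_trans h _; apply: H1.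
  by exists y1 => // y [Ay Dy|/H1//]; apply: le_trans (ltW h) _; apply: H.
- move=> p; have [Dp|nDp] := pselect (D p).
    have [y Dy yp] := better p Dp.
    have cq : ptcont (sqdist z) p.
      apply: ptcont_sum => i; apply: ptcontM; apply: ptcontD;
        (exact: ptcont_coord || exact: ptcont_cst).
    have [e e0 He] := ptcont_gt cq yp.
    by exists e => //; exists y => // y' /He /ltW.
  have [e e0 He] := not_closed_nbhs cD nDp.
  by exists e => //; exists a => // y /He.
apply: nmin.
have far y : ~ (forall i, `|y i| <= B) -> sqdist z a <= sqdist z y.
  move=> /existsNP[i /negP]; rewrite -ltNge => yB.
  have zi : `|z i| <= \sum_(i < N) `|z i| by rewrite (bigD1 i)//= lerDl sumr_ge0.
  have q0 : 0 <= sqdist z a by exact: dotp_ge0.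
  have yz : 1 + sqdist z a <= `|y i - z i|.
    have := lerB_normD (y i) (- z i); rewrite normrN; move: yB; rewrite /B; lra.
  apply: le_trans (sqr_le_dotp (fun i => y i - z i) i).
  rewrite -[leRHS]real_normK ?num_real//; nra.
have [h|h] := leP (sqdist z y0) (sqdist z a).
  exists y0 => // y Dy; have [yB|/far yB] := pselect (forall i, `|y i| <= B).
    exact: Hy0.
  exact: le_trans h yB.
exists a => // y Dy; have [yB|/far//] := pselect (forall i, `|y i| <= B).
exact: le_trans (ltW h) (Hy0 _ yB Dy).
Qed.

(** The normal is [v = p - z] with [p] nearest to [z]: if [v . (y - p) < 0], a small step from [p]
    towards [y] would come closer to [z]. *)
Lemma separation N (D : rvec R N -> Prop) z : is_closed D -> convex_set D ->
  (exists a, D a) -> ~ D z ->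
  exists v c, (forall y, D y -> c <= dotp v y) /\ dotp v z < c.
Proof.
move=> cD xD neD nDz; have [p Dp Hp] := nearest_point z cD neD.
pose v : rvec R N := fun i => p i - z i.
have vv : 0 < dotp v v.
  rewrite lt_neqAle dotp_ge0 andbT; apply/negP => /eqP/esym/dotp_eq0 v0; apply: nDz.
  suff <- : p = z by [].
  apply/funext => i; have : v i = 0 by rewrite v0.
  by rewrite /v; lra.
exists v, (dotp v p); split; last first.
  have -> : dotp v z = dotp v p - dotp v v; last by lra.
  rewrite -dotpN -dotpDr; congr dotp; apply/funext => i; rewrite /v; ring.
move=> y Dy; rewrite leNgt; apply/negP => yp.
pose w : rvec R N := fun i => y i - p i.
have alpha : dotp v w < 0.
  have -> : dotp v w = dotp v y - dotp v p by rewrite -dotpN -dotpDr.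
  lra.
have beta := dotp_ge0 w.
(* The step satisfies [t |w|^2 <= - v . w], so the squared distance changes by
   [2 t v . w + t^2 |w|^2 <= t v . w < 0]. *)
pose t := Num.min 1 (- dotp v w / (dotp w w + 1)).
have w1 : 0 < dotp w w + 1 by rewrite ltr_wpDl.
have t0 : 0 < t by rewrite lt_min ltr01 divr_gt0 ?oppr_gt0.
have t1 : t <= 1 by rewrite ge_min lexx.
have tb : t * dotp w w <= - dotp v w.
  have tb1 : t * (dotp w w + 1) <= - dotp v w.
    by rewrite -ler_pdivlMr// ge_min lexx orbT.
  by apply: le_trans tb1; rewrite mulrDr mulr1 lerDl ltW.
have t01 : 0 <= t <= 1 by rewrite (ltW t0).
have := Hp _ (xD _ _ _ Dp Dy t01); rewrite /sqdist.
have -> : (fun i => (1 - t) * p i + t * y i - z i) = fun i => v i + t * w i.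
  by apply/funext => i; rewrite /v /w; ring.
rewrite -/v sqdotpD.
move: tb alpha t0; clear; clearbody t.
move: (dotp v w) (dotp w w) (dotp v v) => al be ga tb alpha t0.
have h1 : t * (t * be) <= t * - al by rewrite ler_pM2l.
have h2 : t * al < 0 by rewrite pmulr_rlt0.
lra.
Qed.

(** Separate [-y] from [K] by a level [c]. Scaling inside the cone forces [v] to be nonnegative on
    [K], and [- v . y < c <= v . y] gives strict positivity at [y]. *)
Lemma cone_separation N (K : rvec R N -> Prop) y : is_closed K -> convex_set K ->
  (forall t k, 0 < t -> K k -> K (fun i => t * k i)) ->
  K y -> ~ K (fun i => - y i) ->
  exists2 v, (forall k, K k -> 0 <= dotp v k) & 0 < dotp v y.
Proof.
move=> cK xK sK Ky nKy; have [v [c [vK vy]]] := separation cK xK (ex_intro _ y Ky) nKy.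
exists v.
  move=> k Kk; rewrite leNgt; apply/negP => vk.
  (* Scaling by this [t] brings the value of [v] down to [-(|c| + 1)], below [c]. *)
  pose t := (`|c| + 1) / - dotp v k.
  have t0 : 0 < t by rewrite divr_gt0 ?oppr_gt0// ltr_wpDl.
  have := vK _ (sK _ _ t0 Kk); rewrite dotpZr.
  have -> : t * dotp v k = - (`|c| + 1) by rewrite /t; field; rewrite lt_eqF.
  by have := ler_norm (- c); rewrite normrN; lra.
by move: vy (vK _ Ky); rewrite dotpN; lra.
Qed.

End Convexity.

(** * Homogenization, linear forms and the constraints [Gtilde] *)

Section Homogenization.
Set Implicit Arguments.
Unset Strict Implicit.
Context {R : realType}.

Lemma meval_homogenize n (f : {mpoly R[n]}) (y : rvec R n.+1) :
  (homogenize f).@[y] = \sum_(m <- msupp f)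
    f@_m * (y ord0 ^+ (mdegree f - mdeg m) * \prod_(i < n) y (lift ord0 i) ^+ m i).
Proof.
rewrite /homogenize raddf_sum; apply: eq_bigr => m _ /=.
rewrite mevalZ mevalM rmorphXn /= mevalXU rmorph_prod; congr (_ * (_ * _)).
by apply: eq_bigr => i _ /=; rewrite rmorphXn /= mevalXU.
Qed.

Lemma meval_homogenize_scale n (f : {mpoly R[n]}) t (y : rvec R n.+1) :
  (homogenize f).@[fun i => t * y i] = t ^+ mdegree f * (homogenize f).@[y].
Proof.
rewrite !meval_homogenize mulr_sumr big_seq [RHS]big_seq; apply: eq_bigr => m mf.
(* On the support of [f] the truncated difference [mdegree f - mdeg m] is a true one, so every term
   has total degree [mdegree f]. *)
have md : (mdeg m <= mdegree f)%N.
  by have := msize_mdeg_lt mf; rewrite /mdegree; case: (msize f).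
under eq_bigr do rewrite exprMn.
rewrite big_split /= prodrXr -mdegE exprMn.
have -> : t ^+ mdegree f = t ^+ (mdegree f - mdeg m) * t ^+ mdeg m by rewrite -exprD subnK.
by rewrite [RHS]mulrCA; congr (_ * _); exact: mulrACA.
Qed.

Lemma ext1_0 n (x : rvec R n) : ext1 x ord0 = 1.
Proof. by rewrite /ext1 unlift_none. Qed.

Lemma ext1_lift n (x : rvec R n) i : ext1 x (lift ord0 i) = x i.
Proof. by rewrite /ext1 liftK. Qed.

Lemma meval_homogenize_ext1 n (f : {mpoly R[n]}) (x : rvec R n) :
  (homogenize f).@[ext1 x] = f.@[x].
Proof.
rewrite meval_homogenize mevalE; apply: eq_bigr => m _.
rewrite ext1_0 expr1n mul1r; congr (_ * _); apply: eq_bigr => i _.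
by rewrite ext1_lift.
Qed.

Lemma rvec_ext1E n (y : rvec R n.+1) : y ord0 != 0 ->
  y = fun i => y ord0 * ext1 (fun j => y (lift ord0 j) / y ord0) i.
Proof.
move=> y0; apply/funext => i; case: (unliftP ord0 i) => [j|] ->.
  by rewrite ext1_lift mulrC divfK.
by rewrite ext1_0 mulr1.
Qed.

Lemma dotp_ext1 n (v : rvec R n.+1) x :
  dotp v (ext1 x) = v ord0 + dotp (fun j => v (lift ord0 j)) x.
Proof.
rewrite /dotp big_ord_recl ext1_0 mulr1; congr (_ + _).
by apply: eq_bigr => i _; rewrite ext1_lift.
Qed.

Definition linpoly N (v : rvec R N) : {mpoly R[N]} := \sum_(i < N) v i *: 'X_i.

Lemma meval_linpoly N (v y : rvec R N) : (linpoly v).@[y] = dotp v y.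
Proof.
rewrite /linpoly raddf_sum; apply: eq_bigr => i _ /=.
by rewrite mevalZ mevalXU.
Qed.

Lemma linform_linpoly N (v : rvec R N) : linform (linpoly v).
Proof.
apply: rpred_sum => i _; apply: rpredZ.
by rewrite dhomogX /= mdeg1.
Qed.

(** Only the monomials [U_(i)] have degree one, so the coefficients at them determine the form. *)
Lemma linform_dotp N (l : {mpoly R[N]}) : linform l ->
  exists v, forall y, l.@[y] = dotp v y.
Proof.
move=> ll; exists (fun i => l@_U_(i)) => y; rewrite -meval_linpoly; congr meval.
apply/mpolyP => m; rewrite /linpoly raddf_sum /=.
under eq_bigr do rewrite mcoeffZ mcoeffX.
have [/eqP/mdeg1P[i /eqP ->]|/eqP m1] := eqVneq (mdeg m) 1%N.
  rewrite (bigD1 i)//= eqxx mulr1 big1 ?addr0// => j ji.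
  by rewrite eq_mnm1 (negbTE ji) mulr0.
rewrite (dhomog_nemf_coeff ll) ?big1//; last exact/eqP.
move=> i _; case: eqP => [im|_]; last by rewrite mulr0.
by case: m1; rewrite -im mdeg1.
Qed.

Lemma meval_normsq N (y : rvec R N) : (normsq_poly R N).@[y] = dotp y y.
Proof.
rewrite raddf_sum; apply: eq_bigr => i _ /=.
by rewrite rmorphXn /= mevalXU expr2.
Qed.

(** The last two members of [Gtilde] are opposite to each other, which forces the unit norm:
    [Gtilde] describes the spherical section of the cone [Stilde_c]. *)
Lemma Gtilde_ge0P n m (g : 'I_m -> {mpoly R[n]}) (y : rvec R n.+1) :
  (forall h, h \in Gtilde g -> 0 <= h.@[y]) <-> Stilde_c g y /\ dotp y y = 1.
Proof.
split=> [H|[[gy y0] yy] h].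
  have mem_last h : h \in [:: 'X_ord0; normsq_poly R n.+1 - 1; 1 - normsq_poly R n.+1] ->
      0 <= h.@[y] by move=> hh; apply: H; rewrite mem_cat hh orbT.
  split; first split.
  - move=> j; apply: H; rewrite mem_cat; apply/orP; left.
    by apply: map_f; rewrite mem_enum.
  - by rewrite -(@mevalXU _ R y); apply: mem_last; rewrite !inE eqxx.
  - have h1 : 0 <= (normsq_poly R n.+1 - 1).@[y] by apply: mem_last; rewrite !inE eqxx ?orbT.
    have h2 : 0 <= (1 - normsq_poly R n.+1).@[y] by apply: mem_last; rewrite !inE eqxx ?orbT.
    by move: h1 h2; rewrite !mevalB meval1 meval_normsq; lra.
rewrite mem_cat => /orP[/mapP[j _ ->]//|].
rewrite !inE => /or3P[]/eqP ->.
- by rewrite mevalXU.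
- by rewrite mevalB meval1 meval_normsq yy subrr.
- by rewrite mevalB meval1 meval_normsq yy subrr.
Qed.

Lemma Qmod_ge0 N k (H : seq {mpoly R[N]}) p (y : rvec R N) :
  Qmod k H p -> (forall h, h \in H -> 0 <= h.@[y]) -> 0 <= p.@[y].
Proof.
move=> [s0 [s [h0 [_ [hs ->]]]]] Hy; rewrite mevalD raddf_sum addr_ge0 ?is_sos_ge0//.
apply: sumr_ge0 => j _ /=; have [hj _] := hs j.
rewrite mevalM; apply: mulr_ge0; first exact: is_sos_ge0.
by apply: Hy; apply: mem_nth.
Qed.

End Homogenization.

(** * Modified theta bodies and the forms cutting off outside points *)

Section ThetaBody.
Set Implicit Arguments.
Unset Strict Implicit.
Context {R : realType} {n m : nat} (g : 'I_m -> {mpoly R[n]}).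

Local Notation D := (eclosure (cvx_hull (Sset g))).
Local Notation K := (cvx_hull (eclosure (Stilde_o g))).

Lemma THtilde_anti k l x : (k <= l)%N -> THtilde g l x -> THtilde g k x.
Proof. by move=> kl Hx p Hp; apply: Hx; apply: Qmod_leq kl Hp. Qed.

(** A form in the module is nonnegative on the spherical section, hence at [(1, x)] for [x] in [S]
    after normalization; the resulting half-space contains the closed convex hull. *)
Lemma closure_sub_THtilde k x : D x -> THtilde g k x.
Proof.
move=> Dx l Ql ll; have [v lv] := linform_dotp ll; rewrite lv dotp_ext1.
suff : - v ord0 <= dotp (fun j => v (lift ord0 j)) x by lra.
move: x Dx; apply: eclosure_halfspace; apply: cvx_hull_halfspace => x Sx.
suff : 0 <= dotp v (ext1 x) by rewrite dotp_ext1; lra.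
have ee : 0 < dotp (ext1 x) (ext1 x).
  by apply: lt_le_trans (sqr_le_dotp _ ord0); rewrite ext1_0 expr1n.
pose t := (Num.sqrt (dotp (ext1 x) (ext1 x)))^-1.
have t0 : 0 < t by rewrite invr_gt0 sqrtr_gt0.
rewrite -(pmulr_rge0 _ t0) -dotpZr -lv; apply: (Qmod_ge0 Ql); apply/Gtilde_ge0P.
split; first split.
- by move=> j; rewrite meval_homogenize_scale meval_homogenize_ext1 mulr_ge0// exprn_ge0 ?ltW.
- by rewrite ext1_0 mulr1 ltW.
- by rewrite dotpZr dotpZl mulrA -expr2 exprVn sqr_sqrtr ?mulVf// ?gt_eqF// ltW.
Qed.

Lemma Stilde_c_scale t y : 0 < t -> Stilde_c g y -> Stilde_c g (fun i => t * y i).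
Proof.
move=> t0 [gy y0]; split; last by rewrite mulr_ge0// ltW.
by move=> j; rewrite meval_homogenize_scale mulr_ge0// exprn_ge0 ?ltW.
Qed.

(** The vector [v = (-c, w)] homogenizes the separating inequality [c <= w . x]. Division by
    [y_0 > 0] gives it on [Stilde_o], and closedness at infinity extends it to [Stilde_c]. *)
Lemma separating_form x : closed_at_infinity g -> (exists a, D a) -> ~ D x ->
  exists2 v, (forall y, Stilde_c g y -> 0 <= dotp v y) & dotp v (ext1 x) < 0.
Proof.
move=> gcl neD nDx.
have [w [c [wD wx]]] := separation (@eclosure_closed _ _ _)
  (eclosure_convex (@cvx_hull_convex _ _ _)) neD nDx.
pose v : rvec R n.+1 := fun i => if unlift ord0 i is Some j then w j else - c.
have v_ext1 z : dotp v (ext1 z) = dotp w z - c.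
  rewrite dotp_ext1 /v unlift_none addrC; congr (_ - _); congr dotp.
  by apply/funext => j; rewrite liftK.
exists v; last by rewrite v_ext1 subr_lt0.
move=> y /gcl; apply: eclosure_halfspace => {}y [gy y0].
have yE := rvec_ext1E (lt0r_neq0 y0); rewrite yE dotpZr v_ext1.
apply: mulr_ge0; first exact: ltW.
rewrite subr_ge0; apply: wD; apply: sub_eclosure; apply: sub_cvx_hull.
move=> j; have := gy j; rewrite {1}yE meval_homogenize_scale meval_homogenize_ext1.
by rewrite pmulr_rge0// exprn_gt0.
Qed.

(** Pointedness keeps [-y] out of [K] for each unit [y] in the cone, so [cone_separation] gives a
    form positive near [y]. All these forms are nonnegative on the cone, so a finite sum is positive
    wherever one summand is. *)
Lemma strictly_positive_form : AssumptionA g ->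
  exists2 v, (forall y, Stilde_c g y -> 0 <= dotp v y) &
    forall y, (forall h, h \in Gtilde g -> 0 <= h.@[y]) -> 0 < dotp v y.
Proof.
move=> [gcl [Kcl Kpt]].
have Kc y : Stilde_c g y -> K y by move=> /gcl; exact: sub_cvx_hull.
have Kscale t k : 0 < t -> K k -> K (fun i => t * k i).
  move=> t0 [q [lam [pts [l0 [l1 [Ap ya]]]]]].
  exists q, lam, (fun i j => t * pts i j); split=> //; split=> //; split.
    by move=> i; apply/gcl/Stilde_c_scale => //; apply/gcl.
  by move=> j; rewrite ya mulr_sumr; apply: eq_bigr => i _; rewrite mulrCA.
have [|||v vK vG] := @box_induction R n.+1 1 (fun A =>
  exists2 v, (forall y, Stilde_c g y -> 0 <= dotp v y) &
    forall y, A y -> (forall h, h \in Gtilde g -> 0 <= h.@[y]) -> 0 < dotp v y).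
- by move=> A A' sA [v vK vG]; exists v => // y /sA; apply: vG.
- move=> A A' [v vK vG] [v' vK' vG']; exists (fun i => v i + v' i).
    by move=> y Sy; rewrite dotpDl addr_ge0 ?vK ?vK'.
  move=> y Ay Hy; have [Sy _] := (Gtilde_ge0P g y).1 Hy; rewrite dotpDl.
  case: Ay => Ay; first by rewrite ltr_pwDl ?vG ?vK'.
  by rewrite ltr_wpDl ?vG' ?vK.
- move=> y; have [Hy|] := pselect (forall h, h \in Gtilde g -> 0 <= h.@[y]).
    have [Sy yy] := (Gtilde_ge0P g y).1 Hy.
    have nKy : ~ K (fun i => - y i).
      move=> Ky; have y0 := Kpt _ (Kc _ Sy) Ky; move: yy; rewrite y0 /dotp.
      by rewrite big1 => [/esym/eqP|i _]; rewrite ?oner_eq0// mulr0.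
    have [v vK vy] := cone_separation Kcl (@cvx_hull_convex _ _ _) Kscale (Kc _ Sy) nKy.
    have [e e0 He] := ptcont_gt (ptcont_dotp v y) vy.
    exists e => //; exists v; first by move=> k /Kc; apply: vK.
    by move=> k /He.
  (* A constraint negative at [y] stays negative nearby; the section is then absent and the zero
     form serves. *)
  move=> /existsPNP[h hG /negP]; rewrite -ltNge => hy.
  have [e e0 He] := ptcont_lt (ptcont_meval h y) hy.
  exists e => //; exists (fun=> 0).
    by move=> k _; rewrite /dotp big1// => i _; rewrite mul0r.
  by move=> k /He hk /(_ h hG); rewrite leNgt hk.
exists v => // y Hy; apply: vG => // i.
have [_ yy] := (Gtilde_ge0P g y).1 Hy.
by rewrite -sqrtr_sqr -[leRHS]sqrtr1 ler_wsqrtr// -yy sqr_le_dotp.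
Qed.

Lemma cutting_form x : AssumptionA g -> (exists a, D a) -> ~ D x ->
  exists k l, [/\ Qmod k (Gtilde g) l, linform l & l.@[ext1 x] < 0].
Proof.
move=> gA neD nDx.
have [v vS vx] := separating_form gA.1 neD nDx.
have [w wS wG] := strictly_positive_form gA.
(* With this [d] the term [d w] cancels at most half of the negative value of [v] at [(1, x)], while
   [v + d w] is strictly positive on the section. *)
pose d := - dotp v (ext1 x) / 2 / (`|dotp w (ext1 x)| + 1).
have w1 : 0 < `|dotp w (ext1 x)| + 1 by rewrite ltr_wpDl.
have d0 : 0 < d by rewrite !divr_gt0// oppr_gt0.
pose l := linpoly (fun i => v i + d * w i).
have lE y : l.@[y] = dotp v y + d * dotp w y by rewrite meval_linpoly dotpDl dotpZl.
have [||| k Qk] := @putinar_sphere R n.+1 l (Gtilde g).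
- by rewrite mem_cat !inE eqxx !orbT.
- by rewrite mem_cat !inE eqxx !orbT.
- move=> y Hy; have [Sy _] := (Gtilde_ge0P g y).1 Hy.
  rewrite lE; apply: ltr_wpDl; first exact: vS.
  by apply: mulr_gt0 => //; apply: wG.
exists k, l; split=> //; first exact: linform_linpoly.
have dw : d * dotp w (ext1 x) <= - dotp v (ext1 x) / 2.
  apply: (@le_trans _ _ (d * (`|dotp w (ext1 x)| + 1))); last by rewrite divfK ?gt_eqF.
  by rewrite ler_pM2l// (le_trans (ler_norm _))// lerDl.
by rewrite lE; move: dw vx; clear; lra.
Qed.

End ThetaBody.

Theorem mainTheorem9 (R : realType) (n m : nat) (g : 'I_m -> {mpoly R[n]}) :
  AssumptionA g ->
  forall eps r : R, 0 < eps -> 0 < r ->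
  (exists x, eclosure (cvx_hull (Sset g)) x /\ eball r x) ->
  exists k : nat,
    set_sub (fun x => eclosure (cvx_hull (Sset g)) x /\ eball r x)
           (fun x => THtilde g k x /\ eball r x) /\
    set_sub (fun x => THtilde g k x /\ eball r x)
           (fun x => add_eps_ball (eclosure (cvx_hull (Sset g))) eps x /\ eball r x).
Proof.
move=> gA eps r eps0 r0 [x0 [Dx0 _]].
have neD : exists a, eclosure (cvx_hull (Sset g)) a by exists x0.
(* The ball lies in the cube of half-side [r]. A single order for the cube comes from
   [box_induction]; orders merge by maximum, as the theta bodies decrease with [k]. *)
suff [k Hk] : exists k, forall x, (forall i, `|x i| <= r) ->
    THtilde g k x -> add_eps_ball (eclosure (cvx_hull (Sset g))) eps x.
  exists k; split=> x [Hx xr]; split=> //; first exact: closure_sub_THtilde.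
  by apply: Hk => // i; apply: le_trans (norm_le_vnorm x i) xr.
apply: (@box_induction R n r (fun A => exists k, forall x, A x ->
    THtilde g k x -> add_eps_ball (eclosure (cvx_hull (Sset g))) eps x)).
- by move=> A A' sA [k Hk]; exists k => x /sA; apply: Hk.
- move=> A A' [k Hk] [k' Hk']; exists (maxn k k') => x [Ax|Ax] Tx.
    by apply: Hk => //; apply: THtilde_anti Tx; rewrite leq_maxl.
  by apply: Hk' => //; apply: THtilde_anti Tx; rewrite leq_maxr.
move=> x; have [Dx|nDx] := pselect (eclosure (cvx_hull (Sset g)) x).
  have e0 : 0 < (1 : R) / n.+1%:R by rewrite divr_gt0// ltr0n.
  exists (eps * (1 / n.+1%:R)); first by rewrite mulr_gt0.
  (* Near a point [x] of the closed hull the neighbourhood lies in [x + eps B_1] already, so order 0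
     will do. *)
  exists 0%N => y yx _; exists x, (fun i => (y i - x i) / eps); split=> //.
  split; last by move=> i; rewrite mulrC divfK ?gt_eqF// addrC subrK.
  apply: ltW; apply: vnorm_lt => // i.
  by rewrite normrM normfV (gtr0_norm eps0) ltr_pdivrMr// mulrC.
have [k [l [Ql ll lx]]] := cutting_form gA neD nDx.
have [v lv] := linform_dotp ll.
have lx' : dotp (fun j => v (lift ord0 j)) x < - v ord0.
  by move: lx; rewrite lv dotp_ext1; lra.
(* The cutting form stays negative near [x], so no nearby point lies in the theta body of order
   [k]. *)
have [e e0 He] := ptcont_lt (ptcont_dotp _ x) lx'.
exists e => //; exists k => y /He yl /(_ l Ql ll).
by rewrite lv dotp_ext1; lra.
Qed.
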